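(* For all integers $n\ge 0$, $\overline{p}_{\omega}(4n+3)\equiv0\pmod{4}$ and $\overline{p}_{\omega}(8n+6)\equiv0\pmod{4}$.
   Context: An overpartition of $n$ is a partition of $n$ in which the first occurrence of each distinct part may be overlined. $\overline{p}_{\omega}(n)$ denotes the number of overpartitions of $n$ in which the smallest part is overlined and all odd parts are less than twice the smallest part; equivalently $\sum_{n\ge1}\overline{p}_{\omega}(n)q^n=\sum_{n\ge1}\frac{q^n(-q^{n+1};q)_n(-q^{2n+2};q^2)_{\infty}}{(1-q^n)(q^{n+1};q)_n(q^{2n+2};q^2)_{\infty}}$, where $(a;q)_n=\prod_{j=0}^{n-1}(1-aq^j)$ and $(a;q)_\infty=\prod_{j\ge0}(1-aq^j)$. *)

(* Defs.v *)
From mathcomp Require Import all_boot.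
Set Implicit Arguments. Unset Strict Implicit. Unset Printing Implicit Defensive.

(* An overpartition of n is encoded by
   - m : {ffun 'I_n -> 'I_n.+1} : m i is the multiplicity of the part (i+1);
   - ov : {ffun 'I_n -> bool}   : ov i says whether (the first occurrence of)
                                  the part (i+1) is overlined;
   subject to: sum of parts = n, and only parts that occur can be overlined.
   (Multiplicities are automatically <= n.) *)
Definition is_overpartition (n : nat) (m : {ffun 'I_n -> 'I_n.+1})
    (ov : {ffun 'I_n -> bool}) : bool :=
  (\sum_(i < n) i.+1 * m i == n) && [forall i, ov i ==> (0 < m i)].

Definition is_smallest (n : nat) (m : {ffun 'I_n -> 'I_n.+1}) (i : 'I_n) : bool :=
  (0 < m i) && [forall j, (0 < m j) ==> (i <= j)].

Definition pomega_cond (n : nat) (m : {ffun 'I_n -> 'I_n.+1})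
    (ov : {ffun 'I_n -> bool}) : bool :=
  [&& is_overpartition m ov,
      [exists i, is_smallest m i && ov i] &
      [forall i, forall j,
         (is_smallest m i && (0 < m j) && odd j.+1) ==> (j.+1 < 2 * i.+1)]].

Definition pbar_omega (n : nat) : nat :=
  #|[set p : {ffun 'I_n -> 'I_n.+1} * {ffun 'I_n -> bool} | pomega_cond p.1 p.2]|.

(* Main.v *)
(**
An overpartition counted by [pbar_omega N] with [d] distinct part sizes belongs to
a family of [2 ^ d.-1] ones differing only by their overlines, so modulo 4 only [d = 1]
and [d = 2] matter:
  [pbar_omega N = tau N + 2 * T N %[mod 4]],
where [tau] counts divisors and [T N] counts the solutions of [n a + m b = N] in
positive integers with [n < m] and ([m] even or [m < 2 n]).
The parity of [T] follows from Liouville-style substitutions in [n a + m b], mainly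
the conjugation [n a + m b = n (a + b) + (m - n) b] and the exchange of the factors
of both products; the latter has no fixed point of the relevant parities because
[N] is not a sum of an odd and an even square.
For [N = 3 %[mod 4]], [T N] and [tau N / 2] both have the parity of the number of
divisors of [N] congruent to 3; for [N = 2 M] with [M = 3 %[mod 4]], [T N] is even
and 4 divides [tau N = 2 * tau M].
*)

Require Import Defs.
From mathcomp Require Import all_boot.
From mathcomp Require Import zify.
Set Implicit Arguments. Unset Strict Implicit. Unset Printing Implicit Defensive.

(** * Counting through bijections and involutions *)

Lemma count_bij (T U : eqType) (s : seq T) (t : seq U) (P : pred T) (Q : pred U)
    (f : T -> U) (g : U -> T) :
  uniq s -> uniq t ->
  (forall x, x \in s -> P x -> [/\ f x \in t, Q (f x) & g (f x) = x]) ->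
  (forall y, y \in t -> Q y -> [/\ g y \in s, P (g y) & f (g y) = y]) ->
  count P s = count Q t.
Proof.
move=> us ut Hf Hg; rewrite -!size_filter -(size_map f); apply: perm_size.
apply: uniq_perm; last 1 first.
- move=> y; apply/mapP/idP => [[x]|].
    by rewrite !mem_filter => /andP[Px xs] ->; case: (Hf x xs Px) => -> ->.
  rewrite mem_filter => /andP[Qy yt]; case: (Hg y yt Qy) => gs Pg fg.
  by exists (g y); rewrite // mem_filter gs Pg.
- rewrite map_inj_in_uniq ?filter_uniq // => x y.
  rewrite !mem_filter => /andP[Px xs] /andP[Py ys] E.
  by case: (Hf x xs Px) => _ _ <-; case: (Hf y ys Py) => _ _ <-; rewrite E.
- exact: filter_uniq.
Qed.

Lemma count_split (T : Type) (R P : pred T) (s : seq T) :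
  count P s = count (predI P R) s + count (predI P (predC R)) s.
Proof.
rewrite -size_filter -(count_predC R) !count_filter.
by congr (_ + _); apply: eq_count => x /=; rewrite andbC.
Qed.

(** Each orbit [{x, f x}] has one element whose [pickle] code grows under [f] and one whose code
    shrinks, so [f] matches two halves of equal size. *)
Lemma even_count_invol (T : countType) (s : seq T) (P : pred T) (f : T -> T) :
  uniq s ->
  (forall x, x \in s -> P x ->
     [/\ f x \in s, P (f x), f (f x) = x & f x != x]) ->
  ~~ odd (count P s).
Proof.
move=> us Hf; rewrite (count_split (fun x => pickle x < pickle (f x))).
set a := count _ s; suff <- : a = count (predI P
  (predC (fun x => pickle x < pickle (f x)))) s by rewrite addnn odd_double.
apply: (@count_bij _ _ _ _ _ _ f f) => // x xs /andP[Px] /= lt_x;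
  case: (Hf x xs Px) => fs Pf fK fx; split=> //=; rewrite fK Pf /=.
  by rewrite -leqNgt ltnW.
move: lt_x; rewrite -leqNgt leq_eqVlt => /orP[/eqP|//].
by move/(pcan_inj pickleK) => E; rewrite E eqxx in fx.
Qed.

(** * Solutions of [n a + m b = N] in positive integers *)

Definition rep N n a m b := [&& 0 < n, 0 < a, 0 < m, 0 < b & n * a + m * b == N].

(** The box [[0, N]] loses nothing, since positivity bounds each entry of a solution by [N]. *)
Definition quads N : seq (nat * nat * nat * nat) :=
  let r := iota 0 N.+1 in
  [seq q <- [seq (p, b) | p <- [seq (p, m) | p <- [seq (n, a) | n <- r, a <- r],
                                m <- r], b <- r] |
   let: (n, a, m, b) := q in rep N n a m b].

Lemma quads_uniq N : uniq (quads N).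
Proof.
have H (T : eqType) (s : seq T) :
    uniq s -> uniq [seq (x, y) | x <- s, y <- iota 0 N.+1].
  by move=> us; apply: allpairs_uniq; rewrite ?iota_uniq // => -[? ?] [? ?].
by apply/filter_uniq/H/H/H/iota_uniq.
Qed.

Lemma mem_quads N n a m b : ((n, a, m, b) \in quads N) = rep N n a m b.
Proof.
apply/idP/idP => [|R]; first by rewrite mem_filter => /andP[].
rewrite mem_filter; apply/andP; split; first exact: R.
have iN k : k <= N -> k \in iota 0 N.+1 by rewrite mem_iota; lia.
move: R; rewrite /rep => R.
by do 3!(apply: (allpairs_f pair); last by apply: iN; nia); apply: iN; nia.
Qed.

Definition nrep N (P : nat -> nat -> nat -> nat -> bool) :=
  count (fun q => let: (n, a, m, b) := q in P n a m b) (quads N).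

Lemma eq_nrep N (P Q : nat -> nat -> nat -> nat -> bool) :
  (forall n a m b, rep N n a m b -> P n a m b = Q n a m b) -> nrep N P = nrep N Q.
Proof.
by move=> H; apply: eq_in_count => -[[[n a] m] b]; rewrite mem_quads; apply: H.
Qed.

Lemma nrep_split N (R P : nat -> nat -> nat -> nat -> bool) :
  nrep N P = nrep N (fun n a m b => P n a m b && R n a m b)
           + nrep N (fun n a m b => P n a m b && ~~ R n a m b).
Proof.
rewrite /nrep (count_split (fun q => let: (n, a, m, b) := q in R n a m b)).
by congr (_ + _); apply: eq_count => -[[[n a] m] b].
Qed.

Lemma nrep_bij N M (P Q : nat -> nat -> nat -> nat -> bool)
    (f g : nat -> nat -> nat -> nat -> nat * nat * nat * nat) :
  (forall n a m b, rep N n a m b -> P n a m b ->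
     let: (n', a', m', b') := f n a m b in
     [/\ rep M n' a' m' b', Q n' a' m' b' & g n' a' m' b' = (n, a, m, b)]) ->
  (forall n a m b, rep M n a m b -> Q n a m b ->
     let: (n', a', m', b') := g n a m b in
     [/\ rep N n' a' m' b', P n' a' m' b' & f n' a' m' b' = (n, a, m, b)]) ->
  nrep N P = nrep M Q.
Proof.
move=> Hf Hg.
pose F h (q : nat * nat * nat * nat) : nat * nat * nat * nat :=
  let: (n, a, m, b) := q in h n a m b.
apply: (@count_bij _ _ _ _ _ _ (F f) (F g)); rewrite ?quads_uniq //.
- case=> [[[n a] m] b]; rewrite mem_quads => R Pq; move: (Hf _ _ _ _ R Pq) => /=.
  by case: (f n a m b) => [[[n' a'] m'] b']; rewrite mem_quads.
- case=> [[[n a] m] b]; rewrite mem_quads => R Pq; move: (Hg _ _ _ _ R Pq) => /=.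
  by case: (g n a m b) => [[[n' a'] m'] b']; rewrite mem_quads.
Qed.

Lemma nrep_even N (P : nat -> nat -> nat -> nat -> bool)
    (f : nat -> nat -> nat -> nat -> nat * nat * nat * nat) :
  (forall n a m b, rep N n a m b -> P n a m b ->
     let: (n', a', m', b') := f n a m b in
     [/\ rep N n' a' m' b', P n' a' m' b', f n' a' m' b' = (n, a, m, b) &
         (n', a', m', b') != (n, a, m, b)]) ->
  ~~ odd (nrep N P).
Proof.
move=> Hf; apply: (@even_count_invol _ _ _ (fun q => let: (n, a, m, b) := q in
  f n a m b)); first exact: quads_uniq.
case=> [[[n a] m] b]; rewrite mem_quads => R Pq; move: (Hf _ _ _ _ R Pq) => /=.
by case: (f n a m b) => [[[n' a'] m'] b']; rewrite mem_quads.
Qed.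

Lemma odd_rep N n a m b :
  rep N n a m b -> odd N = (odd n && odd a) (+) (odd m && odd b).
Proof. by case/and5P=> _ _ _ _ /eqP <-; rewrite oddD !oddM. Qed.

Ltac solve_quad :=
  rewrite /rep => *; split; first [ lia | by congr (_, _, _, _); lia ].

(** Trades a truncated difference for a fresh positive variable, so that the changes of variables
    below become polynomial identities. *)
Lemma lt_add m n : m < n -> exists2 k, 0 < k & n = m + k.
Proof. by exists (n - m); lia. Qed.

Lemma sqrn_mod4 n : (n * n) %% 4 = odd n.
Proof.
rewrite -{1 2}(odd_double_half n) -muln2.
case: (odd n); set h := n./2; last by rewrite (_ : _ * _ = h * h * 4) ?modnMl //; lia.
by rewrite (_ : _ * _ = (h * h + h) * 4 + 1) ?modnMDl //; lia.
Qed.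

Lemma sum_sqr_odd x y N : odd x != odd y -> x * x + y * y = N -> N %% 4 = 1.
Proof. by move: (sqrn_mod4 x) (sqrn_mod4 y); lia. Qed.

Lemma even_mul_mod4 x y : ~~ odd x -> ~~ odd y -> (x * y) %% 4 = 0.
Proof.
move=> /even_halfK <- /even_halfK <-; rewrite -!muln2.
by rewrite (_ : _ * _ = x./2 * y./2 * 4) ?modnMl //; lia.
Qed.

(** * Conjugation, and the parity of [nT N] for [N = 3 %[mod 4]] *)

(** With [m = n + r] and [s = a + b], the bound [m < 2 n] becomes [r < n] and the positivity of [a]
    becomes [b < s]. *)
Lemma nrep_conj N :
  nrep N (fun n a m b => [&& n < m, odd m & m < 2 * n]) =
  nrep N (fun n s r b => [&& r < n, b < s & odd n != odd r]).
Proof.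
apply: (@nrep_bij _ _ _ _ (fun n a m b => (n, a + b, m - n, b))
                          (fun n s r b => (n, s - b, n + r, b))).
  move=> n a m b R /[dup] Pq /and3P[lt_nm _ _]; move: R Pq.
  by have [r r0 ->] := lt_add lt_nm; rewrite addKn; solve_quad.
move=> n s r b R /[dup] Pq /and3P[_ lt_bs _]; move: R Pq.
by have [a a0 ->] := lt_add lt_bs; rewrite addKn; solve_quad.
Qed.

Definition nopp N := nrep N (fun n s r b =>
  [&& r < n, b < s, odd n != odd r & odd s != odd b]).

(** Exchanging the factors of both products permutes the four conditions. A fixed point would write
    [N] as [n ^ 2 + r ^ 2] with [n], [r] of opposite parity, which is 1 modulo 4. *)
Lemma nopp_even N : N %% 4 != 1 -> ~~ odd (nopp N).
Proof.
move=> N1; apply: (@nrep_even _ _ (fun n s r b => (s, n, b, r))).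
move=> n s r b R Pq; split; first by move: R; rewrite /rep; lia.
- by lia.
- by [].
apply/eqP => -[es _ eb _]; subst s b; move: R Pq => /and5P[_ _ _ _ /eqP e].
by move=> /and4P[_ _ /sum_sqr_odd/(_ e) e1]; rewrite e1 in N1.
Qed.

(* In tuples written [(n, s, r, b)] the pair [(s, r)] stands for [(a + b, m - n)]: they
   are images of [(n, a, m, b)] under the conjugation. *)
Definition nT N := nrep N (fun n a m b => (n < m) && (~~ odd m || (m < 2 * n))).
Definition nA N := nrep N (fun n a m b => (n < m) && ~~ odd m).
Definition nB N := nrep N (fun n s r b =>
  [&& r < n, b < s, odd n != odd r & odd s == odd b]).
(** These are the factorizations [N = n (a + b)] with an ordered splitting of the second factor. *)
Definition nE N := nrep N (fun n a m b => (n == m) && (b < a)).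
Definition nZ N := nrep N (fun n a m b => ~~ odd m && ~~ odd b).

(** Even [m] gives [nA]. The solutions with [m] odd are conjugated and split by whether [s] and [b]
    agree in parity, giving [nB] and the even number [nopp]. *)
Lemma odd_nT N : N %% 4 != 1 -> odd (nT N) = odd (nA N + nB N).
Proof.
move=> N1; rewrite (_ : nT N = nA N + (nB N + nopp N)).
  by rewrite addnA oddD (negbTE (nopp_even N1)) addbF.
rewrite /nT (nrep_split N (fun n a m b => ~~ odd m)); congr addn.
  by apply: eq_nrep => n a m b _; lia.
transitivity (nrep N (fun n a m b => [&& n < m, odd m & m < 2 * n])).
  by apply: eq_nrep => n a m b _; lia.
rewrite nrep_conj (nrep_split N (fun n s r b => odd s == odd b)).
by congr addn; apply: eq_nrep => n a m b _; lia.
Qed.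

(** Only the factors of the first product are exchanged. The second product is 0 modulo 4, so a
    fixed point would make 3 a square modulo 4. *)
Lemma nZ_even N : N %% 4 = 3 -> ~~ odd (nZ N).
Proof.
move=> N3; apply: (@nrep_even _ _ (fun v s R u => (s, v, R, u))).
move=> n s r b R Pq; split; [by move: R; rewrite /rep; lia | by lia | by [] |].
apply/eqP => -[es _]; subst s; move: R Pq => /and5P[_ _ _ _ /eqP e] /andP[er eb].
by move: (sqrn_mod4 n) (even_mul_mod4 er eb); lia.
Qed.

(* After [n s + r b = (n + r) s + 2 r u] with [b = s + 2 u], the solutions with [u] even
   are those of [nZ] with third entry below the first, and conjugation sends the solutions
   with [u] odd to the others. *)
Lemma nrep_lt_gt_nZ N : odd N ->
  nrep N (fun n s r b => [&& r < n, s < b, odd s & odd b]) = nZ N.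
Proof.
move=> N3.
transitivity (nrep N (fun v s R u => (R < v) && ~~ odd R)).
  apply: (@nrep_bij _ _ _ _ (fun n s r b => (n + r, s, r.*2, (b - s)./2))
                            (fun v s R u => (v - R./2, s, R./2, s + u.*2))).
    move=> n s r b R /and4P[rn sb os ob].
    have [u u0 eb]: exists2 u, 0 < u & b = s + u.*2 by exists (b - s)./2; lia.
    by rewrite eb in R *; rewrite addKn !doubleK; move: R; solve_quad.
  move=> v s R u Rp /andP[Rv oR]; have [r r0 eR]: exists2 r, 0 < r & R = r.*2.
    by exists R./2; move: Rp; rewrite /rep; lia.
  subst R; rewrite !doubleK.
  have [n n0 ev]: exists2 n, r < n & v = n + r by exists (v - r); lia.
  by subst v; rewrite addnK; move: Rp (odd_rep Rp); rewrite N3; solve_quad.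
rewrite (nrep_split N (fun v s R u => ~~ odd u)).
rewrite /nZ [RHS](nrep_split N (fun v s R u => R < v)); congr addn.
  by apply: eq_nrep => n a m b _; lia.
apply: (@nrep_bij _ _ _ _ (fun v s R u => (s, v - R, s + u, R))
                          (fun v s R u => (s + u, v, u, R - v))).
  move=> v s R u Rp /andP[/andP[lt oR] ou]; have [k k0 ek] := lt_add lt.
  by subst v; rewrite addKn; move: Rp (odd_rep Rp); rewrite N3; solve_quad.
move=> v s R u Rp /andP[/andP[oR ou] lt].
have [k k0 ek]: exists2 k, 0 < k & R = v + k.
  by exists (R - v); move: (odd_rep Rp); rewrite N3; lia.
by subst R; rewrite addKn; move: Rp (odd_rep Rp); rewrite N3; solve_quad.
Qed.

(** Conjugation followed by the exchange of factors. As [N] is odd, even [m] forces [n] odd, hence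
    [m - n] odd. *)
Lemma nA_swap N : odd N ->
  nA N = nrep N (fun n s r b => [&& r < n, odd s & odd b]).
Proof.
move=> oN; apply: (@nrep_bij _ _ _ _ (fun n a m b => (a + b, n, b, m - n))
                                     (fun n s r b => (s, n - r, s + b, r))).
  move=> n a m b Rp /andP[lt_nm om]; have [r r0 e] := lt_add lt_nm; subst m.
  by rewrite addKn addnK; move: Rp (odd_rep Rp); rewrite oN; solve_quad.
move=> n s r b Rp /and3P[lt_rn os ob]; have [a a0 e] := lt_add lt_rn; subst n.
by rewrite !addKn; move: Rp (odd_rep Rp); rewrite oN; solve_quad.
Qed.

(** In the form given by [nA_swap], the cases [b < s], [s < b] and [s = b] yield the three terms in
    this order. *)
Lemma nA_nB N : odd N -> nA N = nB N + (nZ N + nE N).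
Proof.
move=> oN; rewrite nA_swap // (nrep_split N (fun n s r b => b < s)); congr addn.
  apply: eq_nrep => n s r b /odd_rep; rewrite oN; lia.
rewrite (nrep_split N (fun n s r b => s < b)) -nrep_lt_gt_nZ //; congr addn.
  by apply: eq_nrep => n s r b _; lia.
apply: (@nrep_bij _ _ _ _ (fun n s r b => (s, n, b, r)) (fun n s r b => (s, n, b, r))).
  by move=> n s r b; solve_quad.
by move=> n s r b Rp; move: Rp (odd_rep Rp); rewrite oN; solve_quad.
Qed.

Lemma odd_nT_mod3 N : N %% 4 = 3 -> odd (nT N) = odd (nE N).
Proof.
move=> N3; rewrite odd_nT ?N3 // nA_nB; last by lia.
by rewrite !oddD (negbTE (nZ_even N3)); case: (odd (nB N)); case: (odd (nE N)).
Qed.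

(** * Divisors of an odd number modulo 4 *)

(** For each divisor [x = a + b] of [N], [b] takes [(x - 1) / 2] values, an odd number exactly when
    [x] is 3 modulo 4. *)
Lemma odd_nE N : odd N ->
  odd (nE N) = odd (count (fun x => x %% 4 == 3) (divisors N)).
Proof.
move=> oN; have N0 : 0 < N by lia.
rewrite /nE (nrep_split N (fun n a m b => a.+1 == 3 * b)) oddD.
rewrite [X in _ (+) X](_ : _ = false) ?addbF; last first.
  (* For fixed [a + b = 2 k + 1], reflect [b] in the interval [1, k]; the midpoint,
     which exists when [a + b = 3 %[mod 4]], is [a + 1 = 3 b]. *)
  apply/negbTE/(@nrep_even _ _ (fun n a m b =>
    (n, (a + b)./2 + b, m, (a + b).+1./2 - b))).
  move=> n a m b Rp /andP[/andP[/eqP e lt] ne]; subst m.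
  have [k ek] : exists k, a + b = k.*2.+1.
    exists (a + b)./2; move: (odd_rep Rp); rewrite oN; lia.
  have [c c0 ec]: exists2 c, 0 < c & k.+1 = b + c by exists (k.+1 - b); lia.
  have ea : a = k + c by lia.
  rewrite ek /= -/(k.*2.+2./2) -doubleS !doubleK uphalf_double ec addKn.
  have -> : k + b + c = k.*2.+1 by lia.
  rewrite /= doubleK uphalf_double ec addnK.
  move: Rp => /and5P[n0 a0 _ b0 /eqP e].
  split; [|by lia|by congr (_, _, _, _); lia|by apply/eqP => -[]; lia].
  apply/and5P; split=> //; first by lia.
  by rewrite -mulnDr -e -mulnDr; apply/eqP; congr (_ * _); lia.
congr odd.
(* At a midpoint [a + b = 4 b - 1], so the divisor [x = a + b] determines [b] as [x.+1 %/ 4]. *)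
apply: (@count_bij _ _ _ _ _ _ (fun q : nat * nat * nat * nat =>
  let: (n, a, m, b) := q in a + b)
  (fun x => (N %/ x, x - x.+1 %/ 4, N %/ x, x.+1 %/ 4))).
- exact: quads_uniq.
- exact: divisors_uniq.
- case=> [[[n a] m] b]; rewrite mem_quads => /and5P[n0 a0 m0 b0 /eqP e].
  move=> /andP[/andP[/eqP em lt] /eqP eb]; subst m.
  have eN : N = n * (a + b) by lia.
  rewrite -dvdn_divisors // {1}eN dvdn_mull //.
  have -> : N %/ (a + b) = n by rewrite eN mulnK //; lia.
  by split=> //; [lia | congr (_, _, _, _); lia].
- move=> x; rewrite -dvdn_divisors // mem_quads => /dvdnP[k eN] x3.
  have x0 : 0 < x by lia.
  have -> : N %/ x = k by rewrite eN mulnK.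
  split; last by lia.
    have e : x = (x - x.+1 %/ 4) + x.+1 %/ 4 by lia.
    rewrite /rep -mulnDr -e -eN eqxx andbT; apply/and4P; split; lia.
  by lia.
Qed.

(** The map sending [x] to [N %/ x] exchanges the residues 1 and 3. *)
Lemma size_divisors_mod3 N : N %% 4 = 3 ->
  size (divisors N) = 2 * count (fun x => x %% 4 == 3) (divisors N).
Proof.
move=> N3; have N0 : 0 < N by lia.
have mod3 x y : x * y = N -> (x %% 4 == 3) = (y %% 4 != 3).
  move=> e; have := N3; rewrite -e -modnMm.
  have := ltn_pmod x (isT : 0 < 4); have := ltn_pmod y (isT : 0 < 4).
  by case: (x %% 4) => [|[|[|[|]]]] //; case: (y %% 4) => [|[|[|[|]]]].
rewrite -(count_predC (fun x => x %% 4 == 3)) mul2n -addnn; congr addn.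
have inv x : x %| N -> [/\ N %/ x %| N, x * (N %/ x) = N & N %/ (N %/ x) = x].
  case/dvdnP=> k e; have [x0 k0] : 0 < x /\ 0 < k by move: N0; rewrite e muln_gt0; lia.
  by rewrite e mulnK // mulKn // dvdn_mulr // mulnC.
by apply: (@count_bij _ _ _ _ _ _ (divn N) (divn N)); rewrite ?divisors_uniq // => x;
  rewrite -!dvdn_divisors //= => /inv[? e ?] ?; split=> //;
  move: (mod3 _ _ e); lia.
Qed.

(** * Auxiliary parities for representations of an odd number *)

(** Since [n (a + b)] is odd, [a] and [b] differ, and exchanging the two products pairs the
    solutions. *)
Lemma nE_diag N : odd N -> nrep N (fun n a m b => n == m) = 2 * nE N.
Proof.
move=> oN; rewrite (nrep_split N (fun n a m b => b < a)) mul2n -addnn; congr addn.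
apply: (@nrep_bij _ _ _ _ (fun n a m b => (m, b, n, a)) (fun n a m b => (m, b, n, a))).
  by move=> n a m b Rp; move: Rp (odd_rep Rp); rewrite oN; solve_quad.
by move=> n a m b; solve_quad.
Qed.

Lemma nE_diag_odd N : odd N -> nrep N (fun n a m b => (n == m) && odd b) = nE N.
Proof.
move=> oN; apply: double_inj; rewrite -[RHS]mul2n -nE_diag //.
rewrite [RHS](nrep_split N (fun n a m b => odd b)) -addnn; congr addn.
apply: (@nrep_bij _ _ _ _ (fun n a m b => (m, b, n, a)) (fun n a m b => (m, b, n, a)));
by move=> n a m b Rp; move: Rp (odd_rep Rp); rewrite oN; solve_quad.
Qed.

(** Exactly one product is odd, so there are [2 P] solutions in all, and [P] is even by the exchange
    of factors. Comparing [n] with [m] instead gives [P] as the count for [n < m] plus [nE N]. *)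
Lemma odd_nrep_lt N : N %% 4 = 3 -> odd (nrep N (fun n a m b => n < m)) = odd (nE N).
Proof.
move=> N3; have oN : odd N by lia.
pose P := nrep N (fun n a m b => odd n && odd a).
have evP : ~~ odd P.
  apply: (@nrep_even _ _ (fun n a m b => (a, n, b, m))) => n a m b Rp Pq.
  split; [by move: Rp; rewrite /rep; lia | by lia | by [] |].
  apply/eqP => -[en _ em _]; subst a b; move: Rp (odd_rep Rp) => /and5P[_ _ _ _ /eqP e].
  rewrite oN => op; have := @sum_sqr_odd n m N; lia.
have tot2 : nrep N (fun _ _ _ _ => true) = 2 * P.
  rewrite (nrep_split N (fun n a m b => odd n && odd a)) mul2n -addnn; congr addn.
  apply: (@nrep_bij _ _ _ _ (fun n a m b => (m, b, n, a)) (fun n a m b => (m, b, n, a)));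
  by move=> n a m b Rp; move: Rp (odd_rep Rp); rewrite oN; solve_quad.
have : 2 * P = 2 * nrep N (fun n a m b => n < m) + 2 * nE N.
  rewrite -tot2 (nrep_split N (fun n a m b => n == m)) nE_diag // addnC; congr addn.
  rewrite (nrep_split N (fun n a m b => n < m)) mul2n -addnn; congr addn.
    by apply: eq_nrep => n a m b _; lia.
  by apply: (@nrep_bij _ _ _ _ (fun n a m b => (m, b, n, a)) (fun n a m b => (m, b, n, a)));
  move=> n a m b; solve_quad.
lia.
Qed.

(** After conjugation both pairs [(m, t)] and [(s, a)] have opposite parities. Exchanging the two
    products halves all such solutions in two ways: by [a < s], which is the left side, and by
    [odd m], which is [nZ] because [N] is odd. *)
Lemma nrep_gt_nZ N : odd N ->
  nrep N (fun n a m b => [&& odd n, odd b & m < n]) = nZ N.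
Proof.
move=> oN.
transitivity (nrep N (fun m s t a => [&& odd m != odd t, odd s != odd a & a < s])).
  apply: (@nrep_bij _ _ _ _ (fun n a m b => (m, a + b, n - m, a))
                            (fun m s t a => (m + t, a, m, s - a))).
    move=> n a m b Rp /and3P[? ? lt]; have [t t0 e] := lt_add lt; subst n.
    by rewrite !addKn; move: Rp; solve_quad.
  move=> m s t a Rp /and3P[? ? lt]; have [b b0 e] := lt_add lt; subst s.
  by rewrite !addKn; move: Rp; solve_quad.
apply: double_inj; rewrite -!addnn.
transitivity (nrep N (fun m s t a => (odd m != odd t) && (odd s != odd a))).
  rewrite [RHS](nrep_split N (fun m s t a => a < s)); congr addn.
    by apply: eq_nrep => m s t a _; lia.
  by apply: (@nrep_bij _ _ _ _ (fun n a m b => (m, b, n, a)) (fun n a m b => (m, b, n, a)));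
  move=> n a m b; solve_quad.
rewrite (nrep_split N (fun m s t a => odd m)); congr addn.
  by apply: eq_nrep => m s t a /odd_rep; rewrite oN; lia.
by apply: (@nrep_bij _ _ _ _ (fun n a m b => (m, b, n, a)) (fun n a m b => (m, b, n, a)));
move=> n a m b Rp; move: Rp (odd_rep Rp); rewrite oN; solve_quad.
Qed.

(** The same conjugation as in [nrep_gt_nZ]; the bound [n < m.*2] becomes [t < m]. *)
Lemma nrep_between_nopp N :
  nrep N (fun n a m b => [&& odd n, odd b, m < n & n < m.*2]) = nopp N.
Proof.
apply: (@nrep_bij _ _ _ _ (fun n a m b => (m, a + b, n - m, a))
                          (fun m s t a => (m + t, a, m, s - a))).
  move=> n a m b Rp /and4P[? ? lt ?]; have [t t0 e] := lt_add lt; subst n.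
  by rewrite !addKn; move: Rp; solve_quad.
move=> m s t a Rp /and4P[? lt ? ?]; have [b b0 e] := lt_add lt; subst s.
by rewrite !addKn; move: Rp; solve_quad.
Qed.

(** Comparing [n] with [m] gives [L + nE + nopp] here, and [L + nE + nZ] once the bound [n < m.*2]
    is dropped. The latter sum is even by an involution, and so are [nZ] and [nopp]. *)
Lemma nrep_odd_outer_even N : N %% 4 = 3 ->
  ~~ odd (nrep N (fun n a m b => [&& odd n, odd b & n < m.*2])).
Proof.
move=> N3; have oN : odd N by lia.
pose L := nrep N (fun n a m b => [&& odd n, odd b & n < m]).
have -> : nrep N (fun n a m b => [&& odd n, odd b & n < m.*2]) = L + (nE N + nopp N).
  rewrite (nrep_split N (fun n a m b => n < m)); congr addn.
    by apply: eq_nrep => n a m b _; lia.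
  rewrite (nrep_split N (fun n a m b => n == m)); congr addn.
    rewrite -nE_diag_odd //; apply: eq_nrep => n a m b Rp.
    by move: Rp (odd_rep Rp); rewrite oN /rep; lia.
  by rewrite -nrep_between_nopp; apply: eq_nrep => n a m b _; lia.
have : ~~ odd (L + (nE N + nZ N)).
  rewrite (_ : L + _ = nrep N (fun n a m b => odd n && odd b)).
    (* A fixed point has equal products, which would make [N] even. *)
    apply: (@nrep_even _ _ (fun n a m b => (b, m, a, n))) => n a m b Rp Pq.
    split; [by move: Rp; rewrite /rep; lia | by lia | by [] |].
    apply/eqP => -[en em _ _]; subst b m.
    by move: Rp => /and5P[_ _ _ _ /eqP e]; lia.
  rewrite [RHS](nrep_split N (fun n a m b => n < m)); congr addn.
    by apply: eq_nrep => n a m b _; lia.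
  rewrite [RHS](nrep_split N (fun n a m b => n == m)); congr addn.
    rewrite -nE_diag_odd //; apply: eq_nrep => n a m b Rp.
    by move: (odd_rep Rp); rewrite oN; lia.
  by rewrite -nrep_gt_nZ //; apply: eq_nrep => n a m b _; lia.
have opp : ~~ odd (nopp N) by apply: nopp_even; rewrite N3.
by move: (nZ_even N3) opp; rewrite !oddD; lia.
Qed.

(** * Passage from [M] to [2 M] *)

(** If [s] and [b] were odd, the sum would have the parity of [n + r], which is odd; so both are
    even and can be halved. *)
Lemma nB_double M : odd M -> nB M.*2 = nB M + nopp M.
Proof.
move=> oM; transitivity (nrep M (fun n s r b => [&& r < n, b < s & odd n != odd r])).
  apply: (@nrep_bij _ _ _ _ (fun n s r b => (n, s./2, r, b./2))
                            (fun n s r b => (n, s.*2, r, b.*2))).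
    move=> n s r b Rp Pq; have [x ex] : exists x, s = x.*2.
      by exists s./2; move: (odd_rep Rp); rewrite odd_double; lia.
    have [y ey] : exists y, b = y.*2.
      by exists b./2; move: (odd_rep Rp); rewrite odd_double; lia.
    by subst s b; rewrite !doubleK; move: Rp Pq; solve_quad.
  by move=> n s r b; rewrite !doubleK; solve_quad.
rewrite (nrep_split M (fun n s r b => odd s == odd b)).
by congr addn; apply: eq_nrep => n s r b _; lia.
Qed.

(** Even [m] makes [n a] even: halve [m] together with [n] if [n] is even, and together with [a]
    otherwise. *)
Lemma nA_double M : nA M.*2 =
  nrep M (fun n a m b => n < m) + nrep M (fun n a m b => odd n && (n < m.*2)).
Proof.
rewrite /nA (nrep_split _ (fun n a m b => ~~ odd n)); congr addn.
  apply: (@nrep_bij _ _ _ _ (fun n a m b => (n./2, a, m./2, b))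
                            (fun n a m b => (n.*2, a, m.*2, b))).
    move=> n a m b Rp /andP[/andP[lt om] on].
    have [x ex] : exists x, n = x.*2 by exists n./2; lia.
    have [y ey] : exists y, m = y.*2 by exists m./2; lia.
    by subst n m; rewrite !doubleK; move: Rp; solve_quad.
  by move=> n a m b; rewrite !doubleK; solve_quad.
apply: (@nrep_bij _ _ _ _ (fun n a m b => (n, a./2, m./2, b))
                          (fun n a m b => (n, a.*2, m.*2, b))).
  move=> n a m b Rp /andP[/andP[lt om] on].
  have [y ey] : exists y, m = y.*2 by exists m./2; lia.
  have [x ex] : exists x, a = x.*2.
    by exists a./2; move: (odd_rep Rp); rewrite odd_double; lia.
  by subst a m; rewrite !doubleK; move: Rp; solve_quad.
by move=> n a m b; rewrite !doubleK; solve_quad.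
Qed.

(** Modulo 2 the terms reduce to the count for [n < m] plus [nA M + nB M], and each of these two has
    the parity of [nE M]. *)
Lemma nT_double_even M : M %% 4 = 3 -> ~~ odd (nT M.*2).
Proof.
move=> M3; have oM : odd M by lia.
rewrite odd_nT; last by lia.
rewrite nB_double // nA_double.
(* When [b] is even, moving a factor 2 from [b] to [m] gives the solutions counted by [nA M], where
   [n] is odd because [M] is. *)
have -> : nrep M (fun n a m b => odd n && (n < m.*2)) =
    nA M + nrep M (fun n a m b => [&& odd n, odd b & n < m.*2]).
  rewrite (nrep_split _ (fun n a m b => ~~ odd b)); congr addn.
    apply: (@nrep_bij _ _ _ _ (fun n a m b => (n, a, m.*2, b./2))
                              (fun n a m b => (n, a, m./2, b.*2))).
      move=> n a m b Rp /andP[/andP[lt om] on].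
      have [y ey] : exists y, b = y.*2 by exists b./2; lia.
      by subst b; rewrite !doubleK; move: Rp; solve_quad.
    move=> n a m b Rp /andP[lt om].
    have [y ey] : exists y, m = y.*2 by exists m./2; lia.
    by subst m; rewrite !doubleK; move: Rp (odd_rep Rp); rewrite oM; solve_quad.
  by apply: eq_nrep => n a m b _; lia.
have parity (F A H B O E : nat) : ~~ odd H -> odd F = odd E ->
    odd (A + B) = odd E -> ~~ odd O -> ~~ odd (F + (A + H) + (B + O)).
  rewrite !oddD => /negbTE-> -> <- /negbTE->.
  by case: (odd A); case: (odd B).
apply: parity (nrep_odd_outer_even M3) (odd_nrep_lt M3) _ _.
  by rewrite -odd_nT ?M3 // odd_nT_mod3.
by apply: nopp_even; rewrite M3.
Qed.

Lemma size_divisors_double M : odd M ->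
  size (divisors M.*2) = 2 * size (divisors M).
Proof.
move=> oM; have M0 : 0 < M by lia.
have M20 : 0 < M.*2 by lia.
rewrite -(count_predC odd) mul2n -[RHS]addnn; congr addn.
  rewrite -[RHS]count_predT; apply: (@count_bij _ _ _ _ _ _ id id);
    rewrite ?divisors_uniq // => x; rewrite -!dvdn_divisors //=.
    by move=> d ox; split=> //; rewrite -muln2 Gauss_dvdl // coprimen2 in d.
  by move=> d _; split=> //; [rewrite -muln2 dvdn_mulr | apply: dvdn_odd d oM].
rewrite -[RHS]count_predT; apply: (@count_bij _ _ _ _ _ _ half double);
    rewrite ?divisors_uniq // => x; rewrite -!dvdn_divisors //=.
  by move=> d ox; rewrite even_halfK // -(@dvdn_pmul2l 2) // !mul2n even_halfK.
by move=> d _; rewrite doubleK odd_double -!mul2n dvdn_pmul2l.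
Qed.

(** * Overpartitions as multiplicities with free overlines *)

Section Multiplicities.
Variable N : nat.
Implicit Types (m : {ffun 'I_N -> 'I_N.+1}) (i j k : 'I_N).

Definition supp m := [set i | 0 < m i].

Definition is_part m := \sum_(i < N) i.+1 * m i == N.

Definition odd_bounded m := [forall i, forall j,
  (is_smallest m i && (0 < m j) && odd j.+1) ==> (j.+1 < 2 * i.+1)].

Lemma smallest_uniq m i j : is_smallest m i -> is_smallest m j -> i = j.
Proof.
move=> /andP[mi /forallP si] /andP[mj /forallP sj]; apply: val_inj; apply/eqP.
by rewrite eqn_leq (implyP (si j) mj) (implyP (sj i) mi).
Qed.

Lemma smallest_exists m : 0 < N -> is_part m -> exists i, is_smallest m i.
Proof.
move=> N0 /eqP pm; case: (pickP (fun i => 0 < m i)) => [i mi | m0]; last first.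
  suff e : N = 0 by rewrite e in N0.
  rewrite -[LHS]pm big1 // => i _; have := m0 i.
  by case: (nat_of_ord (m i)) => //; rewrite muln0.
exists [arg min_(i < i | 0 < m i) val i]; case: arg_minnP => // i0 mi0 le.
by rewrite /is_smallest mi0; apply/forallP=> j; apply/implyP; apply: le.
Qed.

(** The overline on the smallest part is forced and the others are free, so overlinings correspond
    to subsets of [supp m :\ i]. *)
Lemma card_overlinings m i : is_smallest m i ->
  #|[set ov : {ffun 'I_N -> bool} | [forall j, ov j ==> (0 < m j)] && ov i]| =
  2 ^ #|supp m|.-1.
Proof.
move=> /andP[mi _]; have -> : #|supp m|.-1 = #|supp m :\ i|.
  by rewrite (cardsD1 i (supp m)) inE mi.
rewrite -card_powerset; pose h (S : {set 'I_N}) := [ffun j => j \in i |: S].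
rewrite -(@card_in_imset _ _ h); last first.
  move=> S1 S2; rewrite !inE !subsetD1 => /andP[_ n1] /andP[_ n2] /ffunP e.
  apply/setP => j; have := e j; rewrite !ffunE !inE.
  by case: eqP => [-> _|//]; rewrite (negbTE n1) (negbTE n2).
apply: eq_card => ov; rewrite inE; apply/andP/imsetP => [[/forallP H oi]|[S]].
  exists ([set j | ov j] :\ i).
    by rewrite inE; apply/subsetP=> j; rewrite !inE => /andP[-> /(implyP (H j))].
  by apply/ffunP=> j; rewrite ffunE !inE; case: eqP => [->|].
rewrite inE => /subsetP sS ->; split; last by rewrite ffunE !inE eqxx.
apply/forallP=> j; rewrite ffunE !inE; apply/implyP=> /orP[/eqP->//|/sS].
by rewrite !inE => /andP[].
Qed.

Lemma pbar_omega_sum : 0 < N ->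
  pbar_omega N = \sum_(m | is_part m && odd_bounded m) 2 ^ #|supp m|.-1.
Proof.
move=> N0; rewrite /pbar_omega -sum1_card.
rewrite (eq_bigl (fun p => true && @pomega_cond N p.1 p.2)); last by move=> p; rewrite inE.
rewrite -(pair_big_dep xpredT (@pomega_cond N) (fun _ _ => 1)) /=.
rewrite [RHS]big_mkcond; apply: eq_bigr => m _; case: ifP => [/andP[pm bm]|nm].
  have [i si] := smallest_exists N0 pm.
  rewrite -(card_overlinings si) sum1dep_card; apply: eq_card => ov.
  rewrite !inE /pomega_cond /is_overpartition; move: pm; rewrite /is_part => -> /=.
  congr andb; move: bm; rewrite /odd_bounded => ->; rewrite andbT.
  apply/existsP/idP => [[j /andP[sj oj]]|oi]; last by exists i; rewrite si.
  by rewrite (smallest_uniq si sj).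
apply: big_pred0 => ov; apply/negbTE; move: nm; apply: contraFN.
by rewrite /pomega_cond /is_overpartition => /and3P[/andP[pm _] _ bm]; rewrite /is_part pm.
Qed.

Definition npart c := #|[set m | [&& is_part m, odd_bounded m & #|supp m| == c]]|.

Lemma pbar_omega_mod4 : 0 < N -> pbar_omega N = npart 1 + 2 * npart 2 %[mod 4].
Proof.
move=> N0; rewrite pbar_omega_sum //.
have card_npart c :
    npart c = \sum_(m | is_part m && odd_bounded m) (#|supp m| == c).
  rewrite /npart -sum1dep_card [LHS]big_mkcond [RHS]big_mkcond.
  by apply: eq_bigr => m _; case: is_part; case: odd_bounded; case: eqP.
rewrite !card_npart big_distrr -big_split /=.
rewrite (eq_bigr (fun m => ((#|supp m| == 1) + 2 * (#|supp m| == 2)) +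
   (if 2 < #|supp m| then 2 ^ (#|supp m| - 3) else 0) * 4)).
  by rewrite big_split -big_distrl /= addnC modnMDl.
move=> m /andP[pm _]; have [i /andP[mi _]] := smallest_exists N0 pm.
(* An empty support must be excluded: [2 ^ 0.-1] is 1, while both indicators vanish. *)
have : 0 < #|supp m| by apply/card_gt0P; exists i; rewrite inE.
case: #|supp m| => [|[|[|c]]] // _.
by rewrite /= !subSS subn0 !expnS; lia.
Qed.

Lemma sum_supp m : \sum_(i < N) i.+1 * m i = \sum_(i in supp m) i.+1 * m i.
Proof.
rewrite [RHS]big_mkcond; apply: eq_bigr => i _; rewrite inE.
by case: (nat_of_ord (m i)) => //=; rewrite muln0.
Qed.

(** The smallest part always satisfies its own bound, so only [j] matters. The case [i = j] serves
    for a single part size. *)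
Lemma odd_bounded2 m i j : supp m = [set i; j] -> i <= j ->
  odd_bounded m = ~~ odd j.+1 || (j.+1 < 2 * i.+1).
Proof.
move=> e le_ij; have inm k : (0 < m k) = (k == i) || (k == j).
  by have := in_set2 k i j; rewrite -e inE.
have si : is_smallest m i.
  rewrite /is_smallest inm eqxx; apply/forallP=> k; apply/implyP.
  by rewrite inm => /orP[] /eqP->.
apply/forallP/idP => [/(_ i)/forallP/(_ j)|H k].
  by rewrite si inm eqxx orbT /= implybE.
apply/forallP=> l; apply/implyP=> /andP[/andP[/(smallest_uniq si) <-]].
rewrite inm => /orP[] /eqP->; last by move=> oj; rewrite oj in H.
by lia.
Qed.

(** With [m = 0] only one part size remains, since [i.+1] is never 0. *)
Definition two_parts (n a m b : nat) : {ffun 'I_N -> 'I_N.+1} :=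
  [ffun i : 'I_N => inord (if i.+1 == n then a else if i.+1 == m then b else 0)].

Lemma two_partsE (n a m b : nat) i : a <= N -> b <= N ->
  two_parts n a m b i = (if i.+1 == n then a else if i.+1 == m then b else 0) :> nat.
Proof. by move=> aN bN; rewrite ffunE inordK //; do 2?case: ifP. Qed.

End Multiplicities.

(** * One part size gives divisors, two part sizes give representations *)

Lemma card_param (T : finType) (U : eqType) (t : seq U) (Q : pred U) (A : {set T})
    (g : U -> T) :
  uniq t ->
  (forall y z, y \in t -> z \in t -> Q y -> Q z -> g y = g z -> y = z) ->
  (forall y, y \in t -> Q y -> g y \in A) ->
  (forall x, x \in A -> exists y, [/\ y \in t, Q y & g y = x]) ->
  #|A| = count Q t.
Proof.
move=> ut gI gA Ag; rewrite cardE -size_filter -(size_map g); apply: perm_size.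
apply: uniq_perm; first exact: enum_uniq.
  rewrite map_inj_in_uniq ?filter_uniq // => y z.
  by rewrite !mem_filter => /andP[? ?] /andP[? ?]; apply: gI.
move=> x; rewrite mem_enum; apply/idP/mapP => [/Ag[y [yt Qy e]]|[y]].
  by exists y; rewrite ?mem_filter ?Qy.
by rewrite mem_filter => /andP[Qy yt] ->; apply: gA.
Qed.

(** A single part size [x] has multiplicity [N %/ x], and the bound on odd parts holds
    automatically. *)
Lemma npart1 N : 0 < N -> npart N 1 = size (divisors N).
Proof.
move=> N0; rewrite -[RHS]count_predT.
have div_bound x : x \in divisors N -> [/\ 0 < x <= N, 0 < N %/ x <= N & x * (N %/ x) = N].
  rewrite -dvdn_divisors // => /dvdnP[k e].
  have [x0 k0] : 0 < x /\ 0 < k by move: N0; rewrite e muln_gt0; lia.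
  by have -> : N %/ x = k; [rewrite e mulnK | split; nia].
apply: (@card_param _ _ _ _ _ (fun x => two_parts N x (N %/ x) 0 0)).
- exact: divisors_uniq.
- move=> x y /div_bound[/andP[x0 xN] /andP[x0' xN'] _] /div_bound[_ /andP[_ yN] _] _ _.
  move=> /ffunP e; have x1 : x.-1 < N by lia.
  have := congr1 val (e (Ordinal x1)); rewrite /= !two_partsE //= prednK // eqxx.
  by case: eqP => // _ e0; rewrite e0 in x0'.
- move=> x /div_bound[/andP[x0 xN] /andP[x0' xN'] e] _.
  have x1 : x.-1 < N by lia.
  have es : supp (two_parts N x (N %/ x) 0 0) = [set Ordinal x1].
    apply/setP=> i; rewrite !inE two_partsE //.
    have -> : (i == Ordinal x1) = (i.+1 == x) by rewrite -val_eqE /=; lia.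
    by case: eqP => // _; case: ifP.
  rewrite inE es cards1 eqxx andbT /is_part sum_supp es big_set1 two_partsE //=.
  rewrite prednK // eqxx e eqxx /= (@odd_bounded2 _ _ (Ordinal x1) (Ordinal x1)) //=.
    by rewrite orbC; lia.
  by rewrite setUid.
move=> m; rewrite inE => /and3P[/eqP pm _ /cards1P[i es]].
have ei : i.+1 * m i = N by rewrite -[RHS]pm sum_supp es big_set1.
exists i.+1; split=> //; first by rewrite -dvdn_divisors // -[X in _ %| X]ei dvdn_mulr.
have ediv : N %/ i.+1 = m i by rewrite -[X in X %/ _]ei mulKn.
have miN : m i <= N by rewrite -ltnS ltn_ord.
rewrite ediv; apply/ffunP=> j; apply: ord_inj; rewrite two_partsE //.
rewrite eqSS; case: eqP => [/val_inj->//|ne].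
have : j \notin supp m by rewrite es inE; apply/eqP => e; apply: ne; rewrite e.
by rewrite inE -eqn0Ngt => /eqP->.
Qed.

(** The sizes are [n < m] with multiplicities [a] and [b]; the bound on odd parts concerns only
    [m]. *)
Lemma npart2 N : npart N 2 = nT N.
Proof.
apply: (@card_param _ _ _ _ _ (fun q : nat * nat * nat * nat =>
  let: (n, a, m, b) := q in two_parts N n a m b)).
- exact: quads_uniq.
- case=> [[[n a] m] b] [[[n' a'] m'] b']; rewrite !mem_quads.
  move=> /and5P[n0 a0 m0 b0 /eqP e] /and5P[n0' a0' m0' b0' /eqP e'].
  move=> /andP[lt _] /andP[lt' _] /ffunP E.
  have {}E k : 0 < k -> k <= N -> (if k == n then a else if k == m then b else 0) =
      (if k == n' then a' else if k == m' then b' else 0).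
    move=> k0 kN; have k1 : k.-1 < N by lia.
    have := congr1 val (E (Ordinal k1)); rewrite /= !two_partsE /= ?prednK //; nia.
  have en : n = n'.
    (* The smaller of [n] and [n'] would have positive multiplicity on one side and 0 on the
       other. *)
    case: (ltngtP n n') => // l.
      by have := E n n0 ltac:(nia); rewrite eqxx (ltn_eqF l) (ltn_eqF (ltn_trans l lt')); lia.
    by have := E n' n0' ltac:(nia); rewrite eqxx (ltn_eqF l) (ltn_eqF (ltn_trans l lt)); lia.
  subst n'; have em : m = m'.
    case: (ltngtP m m') => // l.
      by have := E m m0 ltac:(nia); rewrite eqxx (gtn_eqF lt) (ltn_eqF l); lia.
    by have := E m' m0' ltac:(nia); rewrite eqxx (gtn_eqF lt') (ltn_eqF l); lia.
  subst m'; have := E n n0 ltac:(nia); have := E m m0 ltac:(nia).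
  by rewrite !eqxx (gtn_eqF lt) => -> ->.
- case=> [[[n a] m] b]; rewrite mem_quads.
  move=> /and5P[n0 a0 m0 b0 /eqP e] /andP[lt H].
  have [aN bN] : a <= N /\ b <= N by nia.
  have n1 : n.-1 < N by nia.
  have m1 : m.-1 < N by nia.
  set i := Ordinal n1; set j := Ordinal m1.
  have ne : i != j by rewrite -val_eqE /=; lia.
  have es : supp (two_parts N n a m b) = [set i; j].
    apply/setP=> k; rewrite !inE two_partsE //.
    have -> : (k == i) = (k.+1 == n) by rewrite -val_eqE /=; lia.
    have -> : (k == j) = (k.+1 == m) by rewrite -val_eqE /=; lia.
    by case: (k.+1 == n); case: (k.+1 == m).
  rewrite inE es cards2 ne eqxx andbT /is_part sum_supp es big_setU1 ?inE //= big_set1.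
  rewrite !two_partsE //= !prednK // eqxx (gtn_eqF lt) eqxx e eqxx /=.
  by rewrite (odd_bounded2 es) /= ?prednK //; lia.
move=> m; rewrite inE => /and3P[/eqP pm bm /cards2P[i [j [ne es]]]].
wlog lt : i j ne es / i < j => [W|].
  case: (ltngtP i j) => [lt|lt|/val_inj e]; first exact: (W i j ne es lt).
    by apply: (W j i _ _ lt); [rewrite eq_sym | rewrite setUC].
  by rewrite e eqxx in ne.
have inm k : (0 < m k) = (k == i) || (k == j) by have := in_set2 k i j; rewrite -es inE.
exists (i.+1, nat_of_ord (m i), j.+1, nat_of_ord (m j)); split.
- rewrite mem_quads /rep !inm !eqxx orbT /=; apply/eqP.
  by rewrite -[RHS]pm sum_supp es big_setU1 ?inE //= big_set1.
- by move: bm; rewrite (odd_bounded2 es (ltnW lt)) ltnS lt.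
have mN k : m k <= N by rewrite -ltnS ltn_ord.
apply/ffunP=> k; apply: ord_inj; rewrite two_partsE // !eqSS.
case: eqP => [/val_inj->//|nki]; case: eqP => [/val_inj->//|nkj].
have := inm k; rewrite -!val_eqE /=; move/eqP: nki; move/eqP: nkj => /negbTE-> /negbTE->.
by case: (nat_of_ord (m k)).
Qed.

Lemma pbar_omega_reps N : 0 < N ->
  pbar_omega N = size (divisors N) + 2 * nT N %[mod 4].
Proof. by move=> N0; rewrite pbar_omega_mod4 // npart1 // npart2. Qed.

Theorem theorem1p4 (n : nat) :
  (pbar_omega (4 * n + 3) %% 4 = 0) /\ (pbar_omega (8 * n + 6) %% 4 = 0).
Proof.
have M3 : (4 * n + 3) %% 4 = 3 by lia.
have oM : odd (4 * n + 3) by lia.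
split.
  rewrite pbar_omega_reps; last by lia.
  (* With [c] divisors congruent to 3, the count is [2 c + 2 T] modulo 4, where [T] and [c] have the
     same parity. *)
  by move: (odd_nT_mod3 M3); rewrite (odd_nE oM) (size_divisors_mod3 M3); lia.
have -> : 8 * n + 6 = (4 * n + 3).*2 by lia.
rewrite pbar_omega_reps; last by lia.
(* The divisor count is now [4 c], and [2 T] vanishes modulo 4 because [T] is even. *)
rewrite (size_divisors_double oM) (size_divisors_mod3 M3).
by move: (nT_double_even M3); lia.
Qed.
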